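(* Let $\mathbb{F}\in\{\mathbb{R},\mathbb{C}\}$, let $A$ be an $n\times m$ matrix over $\mathbb{F}$, let $p,q\in(1,\infty]$, and let $\sigma$ be the largest $\ell_1$ norm of the columns of $A$ (so $\sigma=\|A\|_{1,1}$). If $A\in\mathcal{E}_{1,1}(p,q)$, then (i) the entries of any column whose $\ell_1$ norm equals $\sigma$ all have the same absolute value $n^{-1}\sigma$; (ii) every column with this property is orthogonal to all the other columns of $A$; (iii) $\sigma=n^{1-(1/q)}\|A\|_{p,q}$. Conversely, if $A$ has a column all of whose entries have absolute value $n^{-1/q}\|A\|_{p,q}$, then $A\in\mathcal{E}_{1,1}(p,q)$. If $p>2$ and $A\neq0$, then $A\in\mathcal{E}_{1,1}(p,q)$ if and only if $A$ has only one nonzero column and all entries of this column have the same absolute value.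
   Context: $\|x\|_p$ is the Hölder $\ell_p$ norm; $\|A\|_{p,q}=\max_{x\in\mathbb{F}^m,x\ne0}\|Ax\|_q/\|x\|_p$ (for real $A$ one may use $\mathbb{F}=\mathbb{R}$ or $\mathbb{C}$); $1/\infty=0$. Orthogonality is with respect to $\langle a,b\rangle=\sum_i a_i\overline{b_i}$. For $p,q\in(1,\infty]$, $\mathcal{E}_{1,1}(p,q)$ is the set of $n\times m$ matrices $A$ with $\|A\|_{r,s}=n^{(1/s)-(1/q)}\|A\|_{p,q}$ for all $r\in[1,p)$ and $s\in[1,q)$. *)

(* Defs.v *)
From HB Require Import structures.
From mathcomp Require Import all_boot all_order all_algebra.
From mathcomp Require Import all_classical all_reals.
From mathcomp Require Import exp.
From mathcomp.real_closed Require Import complex.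
Set Implicit Arguments. Unset Strict Implicit. Unset Printing Implicit Defensive.
Import Order.TTheory GRing.Theory Num.Theory.
Local Open Scope ring_scope.
Local Open Scope classical_set_scope.

Section NormDefs.
(* R : the reals; F : the scalar field (R itself, or R[i]);
   modF : the absolute value F -> R; conjF : complex conjugation on F. *)
Variables (R : realType) (F : nzRingType) (modF : F -> R) (conjF : F -> F).

Definition lpnorm (p : \bar R) (k : nat) (v : 'I_k -> F) : R :=
  match p with
  | EFin r => (\sum_(i < k) (modF (v i)) `^ r) `^ r^-1
  | +oo%E => \big[Num.max/0]_(i < k) modF (v i)
  | -oo%E => 0
  end.

Definition einv (p : \bar R) : R :=
  match p with EFin r => r^-1 | _ => 0 end.

Definition opnorm (p q : \bar R) (n m : nat) (A : 'M[F]_(n, m)) : R :=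
  sup [set t : R | exists2 x : 'cV[F]_m, x != 0 &
         t = lpnorm q (fun i => (A *m x) i 0) / lpnorm p (fun j => x j 0)].

Definition E11 (p q : \bar R) (n m : nat) (A : 'M[F]_(n, m)) : Prop :=
  forall r s : R, 1 <= r -> (r%:E < p)%E -> 1 <= s -> (s%:E < q)%E ->
    opnorm r%:E s%:E A = (n%:R `^ (s^-1 - einv q)) * opnorm p q A.

Definition colnorm1 (n m : nat) (A : 'M[F]_(n, m)) (j : 'I_m) : R :=
  \sum_(i < n) modF (A i j).
Definition maxcolnorm1 (n m : nat) (A : 'M[F]_(n, m)) : R :=
  \big[Num.max/0]_(j < m) colnorm1 A j.

Definition inner (n : nat) (a b : 'I_n -> F) : F := \sum_(i < n) a i * conjF (b i).

Definition theorem4_for : Prop :=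
  forall (n m : nat) (A : 'M[F]_(n, m)) (p q : \bar R),
    (0 < n)%N -> (0 < m)%N -> (1 < p)%E -> (1 < q)%E ->
    let sigma := maxcolnorm1 A in
    [/\
        (E11 p q A -> forall j : 'I_m, colnorm1 A j = sigma ->
           forall i : 'I_n, modF (A i j) = n%:R^-1 * sigma),
        (E11 p q A -> forall j : 'I_m,
           (forall i : 'I_n, modF (A i j) = n%:R^-1 * sigma) ->
           forall k : 'I_m, k != j ->
             inner (fun i => A i j) (fun i => A i k) = 0),
        (E11 p q A -> sigma = n%:R `^ (1 - einv q) * opnorm p q A),
        ((exists j : 'I_m, forall i : 'I_n,
            modF (A i j) = n%:R `^ (- einv q) * opnorm p q A) -> E11 p q A)
      &
        ((2%:E < p)%E -> A != 0 ->
           (E11 p q A <->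
            exists j : 'I_m,
              (forall k : 'I_m, k != j -> forall i : 'I_n, A i k = 0) /\
              (forall i i' : 'I_n, modF (A i j) = modF (A i' j))))].

End NormDefs.

Definition theorem4_real (R : realType) : Prop :=
  @theorem4_for R R (fun x : R => `|x|) id.

Definition theorem4_complex (R : realType) : Prop :=
  @theorem4_for R (mathcomp.real_closed.complex.complex R) (@mathcomp.real_closed.complex.ComplexField.Normc.normc R) (@mathcomp.real_closed.complex.conjc R).

(* Main.v *)
Require Import Defs.
From mathcomp Require Import all_boot all_order all_algebra.
From mathcomp Require Import all_classical all_reals.
From mathcomp Require Import exp ring lra.
From mathcomp.real_closed Require Import complex.

(* With [c = sigma / n], membership in E_{1,1}(p,q) says that
   [||A x||_s^s <= n c^s ||x||_r^s] for all [r < p] and [s < q].  Since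
   [w^s >= 1 + s (w - 1) + K (w - 1)^2] for some [K > 0] on bounded intervals:
   (i) take [r = 1], [x = e_j]: the numbers [w_i = |a_ij| / c] have mean 1 and
   [sum_i w_i^s <= n], so they all equal 1.
   (ii) take [s = 1], [1 < r], [x = e_j + t e_k]: the left side grows linearly
   in [|t|] for a suitable phase of [t] unless the columns are orthogonal, the
   right side only like [|t|^r].
   (p > 2) take [1 < s <= 2 < r]: now the left side grows quadratically in [t]
   unless column k vanishes, and again the right side only like [|t|^r]. *)

Set Implicit Arguments. Unset Strict Implicit. Unset Printing Implicit Defensive.
Import Order.TTheory GRing.Theory Num.Theory.
Local Open Scope ring_scope.
Local Open Scope classical_set_scope.

(** * Inequalities for real powers *)

Section PowerInequalities.
Variable R : realType.
Implicit Types w x s t : R.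

Lemma ler_powR_base x y s : 0 <= x -> 0 <= s -> x <= y -> x `^ s <= y `^ s.
Proof.
by move=> x0 s0 xy; apply: ge0_ler_powR => //; rewrite nnegrE // (le_trans x0).
Qed.

(** Young's inequality for the product of [x^t] and 1 with exponents [1/t] and [1/(1-t)]; the ends
    [t = 0] and [t = 1], where an exponent would be infinite, are done directly. *)
Lemma powR_le_tangent x t : 0 <= x -> 0 <= t <= 1 -> x `^ t <= 1 + t * (x - 1).
Proof.
move=> x0; case/andP; rewrite le_eqVlt => /predU1P[<-|t0].
  by rewrite powRr0 mul0r addr0.
rewrite le_eqVlt => /predU1P[->|t1]; first by rewrite powRr1 //; lra.
have t1' : 0 < 1 - t by rewrite subr_gt0.
have := @conjugate_powR R (x `^ t) 1 t^-1 (1 - t)^-1 (powR_ge0 _ _) ler01.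
rewrite !invr_gt0 !invrK -powRrM mulfV ?gt_eqF // powRr1 // powR1 mulr1 mul1r.
by move=> /(_ t0 t1'); rewrite addrC subrK => /(_ erefl); lra.
Qed.

(* Writing [w^s = w / (1/w)^(s-1)] and bounding [(1/w)^(s-1)] by its tangent at
   1 gives [w^s >= w^2 / d] with [d = (s-1) + (2-s) w], and
   [w^2 / d = 1 + s (w-1) + (s-1)^2 (w-1)^2 / d] exactly. *)
Lemma powR_ge_quadratic w s M : 0 <= w <= M -> 1 <= M -> 1 < s <= 2 ->
  1 + s * (w - 1) + (s - 1) ^+ 2 / M * (w - 1) ^+ 2 <= w `^ s.
Proof.
move=> /andP[w0 wM] M1 /andP[s1 s2].
have M0 : 0 < M by lra.
pose d := (s - 1) + (2 - s) * w.
(* [d] is a convex combination of 1 and [w] with positive weight on 1. *)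
have d0 : 0 < d by rewrite /d; nra.
have dM : d <= M by rewrite /d; nra.
have ltd : w ^+ 2 / d <= w `^ s.
  move: w0; rewrite le_eqVlt => /predU1P[<-|w0].
    by rewrite expr0n /= mul0r powR_ge0.
  have -> : w `^ s = w * w `^ (s - 1) by rewrite mulr_powRB1 ?ltW//; lra.
  have y0 := powR_gt0 (s - 1) w0.
  have : w^-1 `^ (s - 1) <= 1 + (s - 1) * (w^-1 - 1).
    by apply: powR_le_tangent; rewrite ?invr_ge0 ?(ltW w0) //; lra.
  rewrite -(powR_inv1 (ltW w0)) -powRrM mulrC powRrM powR_inv1 ?(ltW y0) //.
  rewrite (powR_inv1 (ltW w0)) => yle.
  rewrite expr2 -mulrA ler_pM2l // ler_pdivrMr //.
  have : w `^ (s - 1) * w * (w `^ (s - 1))^-1 <=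
         w `^ (s - 1) * w * (1 + (s - 1) * (w^-1 - 1)).
    by rewrite ler_pM2l // mulr_gt0.
  rewrite mulrAC mulfV ?gt_eqF // mul1r => /le_trans; apply.
  by rewrite le_eqVlt; apply/orP; left; apply/eqP; rewrite /d; field; lra.
apply: le_trans ltd.
have -> : w ^+ 2 / d = 1 + s * (w - 1) + (s - 1) ^+ 2 / d * (w - 1) ^+ 2.
  by rewrite /d; field; apply/eqP; rewrite /d in d0; lra.
rewrite lerD2l ler_wpM2r ?sqr_ge0 // ler_wpM2l ?sqr_ge0 //.
by rewrite lef_pV2 // posrE.
Qed.

Lemma le0_of_powR_bound (a K t : R) : 0 < t ->
  (forall e, 0 < e <= 1 -> a <= K * e `^ t) -> a <= 0.
Proof.
move=> t0 H; rewrite leNgt; apply/negP => a0.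
(* [y] is chosen so that [K' * y = a / 2]; taking [e = y^(1/t)] then gives [a <= a / 2]. The maximum
   with [a] makes [K'] positive and [y] at most 1/2. *)
pose K' := Num.max K a; have K'0 : 0 < K' by rewrite lt_max a0 orbT.
pose y := (a / (2 * K')).
have y0 : 0 < y by rewrite divr_gt0 // mulr_gt0.
have y1 : y <= 1.
  rewrite ler_pdivrMr ?mulr_gt0 // mul1r.
  have : a <= K' by rewrite le_max lexx orbT.
  by move=> ?; lra.
have := H (y `^ t^-1); rewrite -powRrM mulVf ?gt_eqF // powRr1 ?(ltW y0) //.
rewrite powR_gt0 // -[X in _ <= X](powRr0 y).
have -> : y `^ t^-1 <= y `^ 0.
  by apply: ger_powR; rewrite ?y0 // invr_ge0 ltW.
move=> /(_ isT).
have : K * y <= K' * y by rewrite ler_pM2r // le_max lexx.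
have -> : K' * y = a / 2 by rewrite /y; field; lra.
by lra.
Qed.

End PowerInequalities.

(** * Comparison of Hölder norms *)

Section LpNorms.
Variables (R : realType) (F : nzRingType) (modF : F -> R).
Hypothesis modF_ge0 : forall x, 0 <= modF x.
Implicit Types (p q : \bar R) (r s : R).

Let lp p k v := @lpnorm R F modF p k v.

Lemma sum_powR_ge0 k (v : 'I_k -> F) r : 0 <= \sum_(i < k) modF (v i) `^ r.
Proof. by apply: sumr_ge0 => i _; exact: powR_ge0. Qed.

Lemma lpnorm_ge0 p k (v : 'I_k -> F) : 0 <= lp p v.
Proof.
case: p => [r| |] //=; first exact: powR_ge0.
by elim/big_ind : _ => // x y x0 y0; rewrite le_max x0.
Qed.

Lemma lpnorm_powR r k (v : 'I_k -> F) : 0 < r ->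
  lp r%:E v `^ r = \sum_(i < k) modF (v i) `^ r.
Proof.
by move=> r0; rewrite /lp /= -powRrM mulVf ?gt_eqF // powRr1 // sum_powR_ge0.
Qed.

Lemma lpnorm1 k (v : 'I_k -> F) : lp 1%:E v = \sum_(i < k) modF (v i).
Proof.
rewrite /lp /= invr1 powRr1 ?sum_powR_ge0 //.
by apply: eq_bigr => i _; rewrite powRr1.
Qed.

Lemma modF_le_lpnorm p k (v : 'I_k -> F) i : (0 < p)%E -> modF (v i) <= lp p v.
Proof.
case: p => [r| |] //=; last by move=> _; apply: le_bigmax.
rewrite lte_fin => r0.
have -> : modF (v i) = (modF (v i) `^ r) `^ r^-1.
  by rewrite -powRrM mulfV ?gt_eqF // powRr1.
apply: ler_powR_base; rewrite ?powR_ge0 ?invr_ge0 ?(ltW r0) //.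
rewrite (bigD1 i) //= lerDl; apply: sumr_ge0 => j _; exact: powR_ge0.
Qed.

Lemma ler_lpnorm_sum r k (v : 'I_k -> F) (C : R) : 0 < r -> 0 <= C ->
  (lp r%:E v <= C) = (\sum_(i < k) modF (v i) `^ r <= C `^ r).
Proof.
move=> r0 C0; rewrite -lpnorm_powR //; apply/idP/idP.
  by apply: ler_powR_base; rewrite ?lpnorm_ge0 // ltW.
rewrite !leNgt; apply: contra => h.
by apply: gt0_ltr_powR; rewrite // nnegrE ?lpnorm_ge0.
Qed.

(** With [L] the [r]-norm, every entry is at most [L], so [|v_i|^p <= L^(p-r) |v_i|^r]; summing
    gives [L^p]. *)
Lemma lpnorm_exponent_le p r k (v : 'I_k -> F) :
  0 < r -> (r%:E <= p)%E -> lp p v <= lp r%:E v.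
Proof.
move=> r0; case: p => [p| |] // rp; last first.
  rewrite {1}/lp /lpnorm; apply: bigmax_le => [|i _]; first exact: lpnorm_ge0.
  exact: modF_le_lpnorm.
move: rp; rewrite lee_fin => rp; have p0 : 0 < p := lt_le_trans r0 rp.
set L := lp r%:E v; have L0 : 0 <= L := lpnorm_ge0 _ _.
rewrite ler_lpnorm_sum //.
have split_p x : x `^ p = x `^ (p - r) * x `^ r.
  by rewrite -powRD ?subrK // (gt_eqF p0).
rewrite split_p {2}/L lpnorm_powR // mulr_sumr; apply: ler_sum => i _.
rewrite split_p; apply: ler_wpM2r; first exact: powR_ge0.
by apply: ler_powR_base; rewrite ?subr_ge0 //; exact: modF_le_lpnorm.
Qed.

(** For finite [p], rescale so that the [p]-th powers of the entries have mean 1 and apply the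
    tangent bound with exponent [s / p] to each: the linear terms sum to zero. *)
Lemma lpnorm_power_mean p s k (v : 'I_k -> F) : (0 < k)%N ->
  0 < s -> (s%:E <= p)%E ->
  lp s%:E v <= k%:R `^ (s^-1 - einv p) * lp p v.
Proof.
move=> k0 s0 sp.
have k0' : 0 < k%:R :> R by rewrite ltr0n.
rewrite ler_lpnorm_sum ?mulr_ge0 ?powR_ge0 ?lpnorm_ge0 //.
rewrite powRM ?powR_ge0 ?lpnorm_ge0 // -powRrM.
case: p sp => [p| |] // sp; rewrite /einv; last first.
  rewrite subr0 mulVf ?gt_eqF // powRr1 ?(ltW k0') //.
  set L := lp _ v; have -> : k%:R * L `^ s = \sum_(i < k) L `^ s.
    by rewrite sumr_const card_ord mulr_natl.
  apply: ler_sum => i _.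
  apply: ler_powR_base; rewrite ?(ltW s0) //.
  exact: (modF_le_lpnorm v i (ltry 0)).
rewrite lee_fin in sp; have p0 : 0 < p := lt_le_trans s0 sp.
set L := lp p%:E v; have L0 : 0 <= L := lpnorm_ge0 _ _.
have pn0 : p != 0 by rewrite gt_eqF.
have [L00|Lgt] := eqVneq L 0.
  rewrite big1 ?mulr_ge0 ?powR_ge0 // => i _.
  have : modF (v i) <= L by apply: modF_le_lpnorm; rewrite lte_fin.
  rewrite L00 => h; have -> : modF (v i) = 0 by apply/eqP; rewrite eq_le h modF_ge0.
  by rewrite powR0 // gt_eqF.
have {Lgt} Lgt : 0 < L by rewrite lt_def Lgt.
(* The normalising factor: the numbers [(|v_i| / M)^p] add up to [k]. *)
pose M := L * k%:R `^ (- p^-1).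
have M0 : 0 < M by rewrite mulr_gt0 // powR_gt0.
have kD x : k%:R * k%:R `^ x = k%:R `^ (1 + x) :> R.
  by rewrite powRD ?powRr1 ?(ltW k0') // (gt_eqF k0') implybT.
have Ms : k%:R `^ ((s^-1 - p^-1) * s) * L `^ s = k%:R * M `^ s.
  rewrite powRM ?powR_ge0 // -powRrM mulrCA mulrC; congr (_ * _).
  by rewrite kD; congr (_ `^ _); field; rewrite pn0 gt_eqF.
rewrite Ms -ler_pdivrMr ?powR_gt0 // mulr_suml.
have sumb : \sum_(i < k) (modF (v i) / M) `^ p = k%:R.
  under eq_bigr do rewrite powRM ?invr_ge0 ?(ltW M0) //.
  rewrite -mulr_suml -lpnorm_powR // -/L -powRM ?invr_ge0 ?(ltW M0) //.
  rewrite /M invfM mulrA mulfV ?gt_eqF // mul1r -powRN opprK -powRrM mulVf //.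
  by rewrite powRr1 // ltW.
apply: (@le_trans _ _ (\sum_(i < k) (1 + s / p * ((modF (v i) / M) `^ p - 1)))).
  apply: ler_sum => i _.
  have -> : modF (v i) `^ s / M `^ s = ((modF (v i) / M) `^ p) `^ (s / p).
    rewrite -powRrM mulrCA mulfV // mulr1 powRM ?invr_ge0 ?(ltW M0) //.
    by rewrite -(powR_inv1 (ltW M0)) -[in RHS]powRrM mulN1r powRN.
  apply: powR_le_tangent; rewrite ?powR_ge0 ?divr_ge0 ?(ltW s0) ?(ltW p0) ?divr_ge0 //=.
  by rewrite ler_pdivrMr // mul1r.
by rewrite big_split /= -mulr_sumr sumrB sumb !sumr_const card_ord subrr mulr0 addr0.
Qed.

Lemma lpnorm_const p k (v : 'I_k -> F) (c : R) : (0 < k)%N -> (0 < p)%E ->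
  (forall i, modF (v i) = c) -> lp p v = k%:R `^ (einv p) * c.
Proof.
move=> k0 p0 vc; have c0 : 0 <= c by rewrite -(vc (Ordinal k0)).
case: p p0 => [p| |] //=.
  rewrite lte_fin => p0; under eq_bigr do rewrite vc.
  rewrite sumr_const card_ord -[_ `^ _ *+ _]mulr_natl powRM ?powR_ge0 ?ler0n //.
  by rewrite -powRrM mulfV ?gt_eqF // powRr1.
move=> _; rewrite powRr0 mul1r; apply/eqP; rewrite eq_le; apply/andP; split.
  by apply: bigmax_le => // i _; rewrite vc.
by rewrite -(vc (Ordinal k0)); apply: (modF_le_lpnorm v _ (ltry 0)).
Qed.

Lemma lpnorm_single p k (v : 'I_k -> F) j : (0 < p)%E ->
  (forall i, i != j -> modF (v i) = 0) -> lp p v = modF (v j).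
Proof.
move=> p0 v0; case: p p0 => [p| |] //=.
  rewrite lte_fin => p0; rewrite (bigD1 j) //= big1 ?addr0 => [|i ij].
    by rewrite -powRrM mulfV ?gt_eqF // powRr1.
  by rewrite v0 // powR0 // gt_eqF.
move=> _; apply/eqP; rewrite eq_le; apply/andP; split.
  apply: bigmax_le => // i _; have [->//|ij] := eqVneq i j; by rewrite v0.
by apply: (modF_le_lpnorm v _ (ltry 0)).
Qed.

End LpNorms.

(** * Choice of exponents below [p] and [q] *)

Lemma ereal_between (R : realType) (a : R) (p : \bar R) : (a%:E < p)%E ->
  exists2 r : R, a < r & (r%:E < p)%E.
Proof.
case: p => [p| |] //; last by exists (a + 1); [rewrite ltrDl|exact: ltry].
by rewrite lte_fin => ap; exists ((a + p) / 2); rewrite ?lte_fin; lra.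
Qed.

(** The cap at 2 meets the range of [powR_ge_quadratic], and keeps [s] below any [r > 2]. *)
Lemma exponent_between12 (R : realType) (q : \bar R) : (1 < q)%E ->
  exists2 s : R, 1 < s <= 2 & (s%:E < q)%E.
Proof.
move=> /ereal_between[s s1 sq]; exists (Num.min 2 s).
  by rewrite lt_min s1 andbT ltr1n ge_min lexx.
by apply: le_lt_trans sq; rewrite lee_fin ge_min lexx orbT.
Qed.

(** * Algebra of an abstract modulus with conjugation *)

(* Treats [F = R] and [F = R[i]] uniformly; [ofR] embeds the reals in [F]. *)
Section Modulus.
Variables (R : realType) (F : fieldType) (modF : F -> R).
Variables (conjF : {rmorphism F -> F}) (ofR : {rmorphism R -> F}).
Hypothesis modF_ge0 : forall x, 0 <= modF x.
Hypothesis modFD : forall x y, modF (x + y) <= modF x + modF y.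
Hypothesis modF_sqr : forall x, x * conjF x = ofR (modF x ^+ 2).
Hypothesis conjFK : involutive conjF.
Hypothesis conjF_ofR : forall a, conjF (ofR a) = ofR a.
Implicit Types (p q : \bar R) (r s : R) (n m : nat).

Let lp p k v := @lpnorm R F modF p k v.

(** Multiplicativity, invariance under conjugation and the values on reals all follow from this
    characterisation of the modulus as a nonnegative square root. *)
Lemma modF_unique x a : 0 <= a -> x * conjF x = ofR (a ^+ 2) -> modF x = a.
Proof.
by move=> a0; rewrite modF_sqr => /fmorph_inj /eqP; rewrite eqrXn2 // => /eqP.
Qed.

Lemma modF_ofR a : modF (ofR a) = `|a|.
Proof. by apply: modF_unique; rewrite // conjF_ofR -rmorphM real_normK ?num_real. Qed.

Lemma modFM x y : modF (x * y) = modF x * modF y.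
Proof.
by apply: modF_unique; rewrite ?mulr_ge0 // rmorphM mulrACA !modF_sqr -rmorphM exprMn.
Qed.

Lemma modF_conj x : modF (conjF x) = modF x.
Proof. by apply: modF_unique => //; rewrite conjFK mulrC modF_sqr. Qed.

Lemma modF0 : modF 0 = 0.
Proof. by rewrite -(rmorph0 ofR) modF_ofR normr0. Qed.

Lemma modF1 : modF 1 = 1.
Proof. by rewrite -(rmorph1 ofR) modF_ofR normr1. Qed.

Lemma modF_eq0 x : modF x = 0 -> x = 0.
Proof.
move=> x0; have /eqP := modF_sqr x.
by rewrite x0 expr0n /= rmorph0 mulf_eq0 fmorph_eq0 orbb => /eqP.
Qed.

Lemma ler_modF_sum (I : finType) (f : I -> F) :
  modF (\sum_i f i) <= \sum_i modF (f i).
Proof.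
elim/big_ind2 : _ => [|x a y b xa yb|//]; first by rewrite modF0.
exact: le_trans (modFD _ _) (lerD xa yb).
Qed.

(** * Operator norms as suprema, and the columns *)

Section OperatorNorm.
Variables (n m : nat) (A : 'M[F]_(n, m)).

Let sigma := maxcolnorm1 modF A.

Lemma colnorm1_le_max j : colnorm1 modF A j <= sigma.
Proof. exact: le_bigmax. Qed.

Lemma maxcolnorm1_ge0 : 0 <= sigma.
Proof.
by rewrite /sigma /maxcolnorm1; elim/big_ind : _ => [//|x y x0 _|j _];
  rewrite ?le_max ?x0 // sumr_ge0.
Qed.

Lemma sum_modF_mulmx (x : 'cV[F]_m) :
  \sum_i modF ((A *m x) i 0) <= sigma * \sum_j modF (x j 0).
Proof.
apply: (@le_trans _ _ (\sum_i \sum_j modF (A i j * x j 0))).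
  by apply: ler_sum => i _; rewrite mxE ler_modF_sum.
rewrite exchange_big mulr_sumr /=; apply: ler_sum => j _.
under eq_bigr do rewrite modFM.
by rewrite -mulr_suml ler_wpM2r // colnorm1_le_max.
Qed.

Lemma lpnorm_gt0 p (x : 'cV[F]_m) : (0 < p)%E -> x != 0 -> 0 < lp p (x ^~ 0).
Proof.
move=> p0 /cV0Pn [j xj]; apply: (@lt_le_trans _ _ (modF (x j 0))).
  by rewrite lt_def modF_ge0 andbT; apply: contra xj => /eqP/modF_eq0 ->.
exact: (modF_le_lpnorm modF_ge0 (x ^~ 0)).
Qed.

Lemma lpnorm_delta p (j : 'I_m) : (0 < p)%E ->
  lp p (fun i => (delta_mx j 0 : 'cV[F]_m) i 0) = 1.
Proof.
move=> p0; rewrite /lp (@lpnorm_single _ _ _ modF_ge0 p _ _ j) // => [|i /negPf ij].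
  by rewrite mxE !eqxx modF1.
by rewrite mxE ij modF0.
Qed.

Lemma mulmx_delta j : (fun i => (A *m (delta_mx j 0 : 'cV_m)) i 0) = (A ^~ j).
Proof. by apply/funext => i; rewrite -colE mxE. Qed.

Lemma delta_cV_neq0 (j : 'I_m) : (delta_mx j 0 : 'cV[F]_m) != 0.
Proof. by apply/cV0Pn; exists j; rewrite mxE !eqxx oner_eq0. Qed.

Lemma lpnorm_mulmx_le p q (x : 'cV[F]_m) : (1 <= p)%E -> (1 <= q)%E -> x != 0 ->
  lp q (fun i => (A *m x) i 0) <= opnorm modF p q A * lp p (x ^~ 0).
Proof.
move=> p1 q1 x0; have p0 : (0 < p)%E := lt_le_trans lte01 p1.
rewrite -ler_pdivrMr ?lpnorm_gt0 //; apply: ub_le_sup; last by exists x.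
(* The supremum is meaningful only for a bounded set; the crude bound comes from [||Ay||_q <=
   ||Ay||_1 <= sigma ||y||_1 <= sigma m ||y||_p]. *)
exists (sigma * m%:R) => _ [y y0 ->]; rewrite ler_pdivrMr ?lpnorm_gt0 //.
apply: le_trans (lpnorm_exponent_le modF_ge0 _ ltr01 q1) _.
rewrite lpnorm1 //; apply: le_trans (sum_modF_mulmx y) _.
rewrite -mulrA ler_wpM2l ?maxcolnorm1_ge0 //.
have -> : m%:R * lp p (y ^~ 0) = \sum_(i < m) lp p (y ^~ 0).
  by rewrite sumr_const card_ord mulr_natl.
by apply: ler_sum => j _; exact: (modF_le_lpnorm modF_ge0 (y ^~ 0)).
Qed.

Lemma opnorm_le p q C : (0 < m)%N -> (0 < p)%E ->
  (forall x : 'cV[F]_m, x != 0 ->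
     lp q (fun i => (A *m x) i 0) <= C * lp p (x ^~ 0)) ->
  opnorm modF p q A <= C.
Proof.
move=> m0 p0 h; apply: ge_sup.
  (* A basis vector shows that the set of quotients is nonempty. *)
  pose x : 'cV[F]_m := delta_mx (Ordinal m0) 0.
  exists (lp q (fun i => (A *m x) i 0) / lp p (x ^~ 0)).
  by exists x; first exact: delta_cV_neq0.
by move=> _ [x x0 ->]; rewrite ler_pdivrMr ?lpnorm_gt0 //; exact: h.
Qed.

Lemma lpnorm_col_le p q j : (1 <= p)%E -> (1 <= q)%E ->
  lp q (A ^~ j) <= opnorm modF p q A.
Proof.
move=> p1 q1; rewrite -mulmx_delta.
have := lpnorm_mulmx_le p1 q1 (delta_cV_neq0 j).
by rewrite lpnorm_delta ?mulr1 // (lt_le_trans lte01 p1).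
Qed.

Lemma opnorm_ge0 p q : (0 < m)%N -> (1 <= p)%E -> (1 <= q)%E ->
  0 <= opnorm modF p q A.
Proof.
move=> m0 p1 q1; apply: le_trans (lpnorm_col_le (Ordinal m0) p1 q1).
exact: lpnorm_ge0.
Qed.

Lemma opnorm11 : (0 < m)%N -> opnorm modF 1%:E 1%:E A = sigma.
Proof.
move=> m0; apply/eqP; rewrite eq_le; apply/andP; split.
  by apply: opnorm_le => // x x0; rewrite /lp !lpnorm1 // sum_modF_mulmx.
apply: bigmax_le => [|j _]; first exact: opnorm_ge0.
apply: le_trans (lpnorm_col_le j (lexx _) (lexx _)).
by rewrite /lp lpnorm1.
Qed.

End OperatorNorm.

(** * Structure of the matrices in E_{1,1}(p,q) *)

Section ExtremalMatrices.
Variables (n m : nat) (A : 'M[F]_(n, m)) (p q : \bar R).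
Hypotheses (n_gt0 : (0 < n)%N) (m_gt0 : (0 < m)%N).
Hypotheses (p_gt1 : (1 < p)%E) (q_gt1 : (1 < q)%E).

Let sigma := maxcolnorm1 modF A.
Let c := n%:R^-1 * sigma.

Let n_gt0R : 0 < n%:R :> R. Proof. by rewrite ltr0n. Qed.
Let p_ge1 : (1 <= p)%E. Proof. exact: ltW. Qed.
Let q_ge1 : (1 <= q)%E. Proof. exact: ltW. Qed.
Let p_gt0 : (0 < p)%E. Proof. exact: lt_trans lte01 p_gt1. Qed.
Let q_gt0 : (0 < q)%E. Proof. exact: lt_trans lte01 q_gt1. Qed.
Let c_ge0 : 0 <= c. Proof. by rewrite mulr_ge0 ?invr_ge0 ?ler0n ?maxcolnorm1_ge0. Qed.

Let ncc_ge0 : 0 <= n%:R * c ^+ 2. Proof. by rewrite mulr_ge0 ?sqr_ge0. Qed.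

Lemma E11_sigma : E11 modF p q A -> sigma = n%:R `^ (1 - einv q) * opnorm modF p q A.
Proof.
by move=> /(_ 1 1 (lexx _) p_gt1 (lexx _) q_gt1); rewrite invr1 opnorm11.
Qed.

(** [E11_sigma] eliminates the norm at [(p,q)] in favour of [c], leaving [p] and [q] only as strict
    bounds on [r] and [s]. *)
Lemma E11_opnorm r s : E11 modF p q A ->
  1 <= r -> (r%:E < p)%E -> 1 <= s -> (s%:E < q)%E ->
  opnorm modF r%:E s%:E A = n%:R `^ s^-1 * c.
Proof.
move=> EA r1 rp s1 sq; rewrite EA // /c E11_sigma // !mulrA; congr (_ * _).
rewrite -[n%:R^-1]powR_inv1 ?ler0n // -!powRD ?(gt_eqF n_gt0R) ?implybT //.
by congr (_ `^ _); ring.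
Qed.

Lemma E11_sum_powR r s (x : 'cV[F]_m) : E11 modF p q A ->
  1 <= r -> (r%:E < p)%E -> 1 <= s -> (s%:E < q)%E -> x != 0 ->
  \sum_i modF ((A *m x) i 0) `^ s <=
    n%:R * c `^ s * (\sum_j modF (x j 0) `^ r) `^ (s / r).
Proof.
move=> EA r1 rp s1 sq x0.
have s0 : 0 < s := lt_le_trans ltr01 s1.
have r0 : 0 < r := lt_le_trans ltr01 r1.
have rE : (1 <= r%:E)%E by rewrite lee_fin.
have sE : (1 <= s%:E)%E by rewrite lee_fin.
have := lpnorm_mulmx_le A rE sE x0.
have C0 : 0 <= n%:R `^ s^-1 * c := mulr_ge0 (powR_ge0 _ _) c_ge0.
have lp0 := lpnorm_ge0 modF_ge0 r%:E (x ^~ 0).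
rewrite E11_opnorm // /lp (ler_lpnorm_sum modF_ge0 _ s0 (mulr_ge0 C0 lp0)).
move=> /le_trans; apply; rewrite (powRM _ C0 lp0) (powRM _ (powR_ge0 _ _) c_ge0).
rewrite -powRrM mulVf ?gt_eqF // powRr1 ?ler0n //.
by rewrite /lpnorm -powRrM [r^-1 * s]mulrC.
Qed.

Lemma E11_two_columns r s (t : F) j k : E11 modF p q A ->
  1 <= s <= r -> (r%:E < p)%E -> (s%:E < q)%E -> k != j ->
  \sum_i modF (A i j + t * A i k) `^ s <= n%:R * c `^ s * (1 + modF t `^ r).
Proof.
move=> EA /andP[s1 sr] rp sq kj.
have s0 : 0 < s := lt_le_trans ltr01 s1.
have r0 : 0 < r := lt_le_trans s0 sr.
pose x : 'cV[F]_m := delta_mx j 0 + t *: delta_mx k 0.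
have xj : x j 0 = 1 by rewrite !mxE !eqxx [j == k]eq_sym (negPf kj) mulr0 addr0.
have xk : x k 0 = t by rewrite !mxE !eqxx (negPf kj) mulr1 add0r.
have xl l : l != j -> l != k -> x l 0 = 0.
  by move=> /negPf lj /negPf lk; rewrite !mxE lj lk mulr0 addr0.
have x0 : x != 0 by apply/cV0Pn; exists j; rewrite xj oner_eq0.
have := E11_sum_powR EA (le_trans s1 sr) rp s1 sq x0.
have -> : \sum_l modF (x l 0) `^ r = 1 + modF t `^ r.
  rewrite (bigD1 j) //= (bigD1 k) //= xj xk modF1 powR1 big1 ?addr0 //.
  by move=> l /andP[lj lk]; rewrite xl // modF0 powR0 // gt_eqF.
have Ax i : (A *m x) i 0 = A i j + t * A i k.
  by rewrite mulmxDr -scalemxAr -!colE !mxE.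
under eq_bigr do rewrite Ax.
move=> /le_trans; apply; rewrite ler_wpM2l ?mulr_ge0 ?powR_ge0 ?ler0n //.
by apply: ler1_powR; rewrite ?lerDl ?powR_ge0 // ler_pdivrMr // mul1r.
Qed.

Lemma E11_max_column_const j : E11 modF p q A -> colnorm1 modF A j = sigma ->
  forall i, modF (A i j) = c.
Proof.
move=> EA js i.
have le_sigma l : modF (A l j) <= sigma.
  by rewrite -js /colnorm1 (bigD1 l) //= lerDl sumr_ge0.
(* If [c = 0] then [sigma = 0] and the column vanishes; otherwise one may divide by [c]. *)
have [c0|c_neq0] := eqVneq c 0.
  have s0 : sigma = 0.
    by move/eqP: c0; rewrite mulf_eq0 invr_eq0 (gt_eqF n_gt0R) => /eqP.
  by rewrite c0; apply/eqP; rewrite eq_le modF_ge0 -s0 le_sigma.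
have c_gt0 : 0 < c by rewrite lt_def c_neq0 c_ge0.
have [s /andP[s1 s2] sq] := exponent_between12 q_gt1.
pose w l := modF (A l j) / c.
have w0 l : 0 <= w l by rewrite divr_ge0.
have sum_w : \sum_l w l = n%:R.
  rewrite -mulr_suml -/(colnorm1 modF A j) js /c; field.
  rewrite (gt_eqF n_gt0R) /=; apply: contra c_neq0 => /eqP s0.
  by rewrite /c s0 mulr0.
have sum_ws : \sum_l w l `^ s <= n%:R.
  have := E11_sum_powR EA (lexx _) p_gt1 (ltW s1) sq (delta_cV_neq0 j).
  have -> : \sum_l modF ((delta_mx j 0 : 'cV[F]_m) l 0) `^ 1 = 1.
    rewrite (bigD1 j) //= big1 => [|l /negPf lj].
      by rewrite mxE !eqxx modF1 powR1 addr0.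
    by rewrite mxE lj modF0 powR0 // oner_eq0.
  rewrite powR1 mulr1 => h; rewrite /w.
  under eq_bigr do rewrite powRM ?invr_ge0 // -(powR_inv1 c_ge0) powRAC.
  rewrite -mulr_suml powR_inv1 ?powR_ge0 // ler_pdivrMr ?powR_gt0 //.
  apply: le_trans h; rewrite le_eqVlt; apply/orP; left; apply/eqP.
  by apply: eq_bigr => l _; rewrite -colE mxE.
(* Nonnegative numbers with sum [n] are at most [n], which serves as the bound [M] of the quadratic
   estimate. *)
have wn l : 0 <= w l <= n%:R.
  by rewrite w0 -sum_w (bigD1 l) //= lerDl sumr_ge0.
have n1 : 1 <= n%:R :> R by rewrite ler1n.
have w_ge l : 1 + s * (w l - 1) + (s - 1) ^+ 2 / n%:R * (w l - 1) ^+ 2 <= w l `^ s.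
  by apply: powR_ge_quadratic; rewrite ?wn ?s1.
(* Summing the quadratic estimates, the linear terms cancel since the mean is 1, and a positive
   multiple of the sum of squares is at most 0. *)
have /eqP : \sum_l (w l - 1) ^+ 2 = 0.
  apply/eqP; rewrite eq_le sumr_ge0 ?andbT => [|l _]; last exact: sqr_ge0.
  have K0 : 0 < (s - 1) ^+ 2 / n%:R by rewrite divr_gt0 // exprn_gt0 // subr_gt0.
  rewrite -(pmulr_rle0 _ K0).
  have := le_trans (ler_sum _ (fun l _ => w_ge l)) sum_ws.
  rewrite !big_split /= -!mulr_sumr sumrB sum_w !sumr_const card_ord.
  by rewrite subrr mulr0 addr0 gerDl.
rewrite psumr_eq0 => [/allP /(_ i (mem_index_enum _))|l _]; last exact: sqr_ge0.
by rewrite /= sqrf_eq0 subr_eq0 => /eqP wi; rewrite -[RHS]mul1r -wi divfK.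
Qed.

(** Duality with column [j]: bounds the 1-norm of a perturbed column [y] from below by its pairing
    with the unperturbed one. *)
Lemma modF_sum_conj_le j (y : 'I_n -> F) : (forall i, modF (A i j) = c) ->
  modF (\sum_i conjF (A i j) * y i) <= c * \sum_i modF (y i).
Proof.
move=> jc; apply: le_trans (ler_modF_sum _) _.
by rewrite mulr_sumr; apply: ler_sum => i _; rewrite modFM modF_conj jc.
Qed.

Lemma sum_conj_col j : (forall i, modF (A i j) = c) ->
  \sum_i conjF (A i j) * A i j = ofR (n%:R * c ^+ 2).
Proof.
move=> jc; under eq_bigr do rewrite mulrC modF_sqr jc.
by rewrite -rmorph_sum sumr_const card_ord mulr_natl.
Qed.

Lemma sum_conj_colD j (b : 'I_n -> F) t : (forall i, modF (A i j) = c) ->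
  \sum_i conjF (A i j) * (A i j + t * b i) =
  ofR (n%:R * c ^+ 2) + t * \sum_i conjF (A i j) * b i.
Proof.
move=> jc; rewrite -(sum_conj_col jc) mulr_sumr -big_split /=.
by apply: eq_bigr => i _; ring.
Qed.

Lemma E11_column_orthogonal j k : E11 modF p q A ->
  (forall i, modF (A i j) = c) -> k != j ->
  \sum_i conjF (A i j) * A i k = 0.
Proof.
move=> EA jc kj; set D := \sum_i _; apply: modF_eq0; apply: contrapT => /eqP dn0.
have d0 : 0 < modF D by rewrite lt_def dn0 modF_ge0.
have [r r1 rp] := ereal_between p_gt1.
suff : modF D <= 0 by rewrite leNgt d0.
apply: (@le0_of_powR_bound R _ (n%:R * c ^+ 2) (r - 1)); first by rewrite subr_gt0.
move=> e /andP[e0 _].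
(* The phase of [t] makes [t * D] the nonnegative real [e |D|], while [|t| = e]. *)
pose t := ofR (e / modF D) * conjF D.
have modt : modF t = e.
  by rewrite modFM modF_conj modF_ofR ger0_norm ?divfK // divr_ge0 // ltW.
have tD : t * D = ofR (e * modF D).
  by rewrite /t -mulrA [conjF D * D]mulrC modF_sqr -rmorphM; congr (ofR _); field.
have := @E11_two_columns r 1 t j k EA.
rewrite lexx (ltW r1) modt => /(_ isT rp q_gt1 kj) ub.
have := modF_sum_conj_le (fun i => A i j + t * A i k) jc.
rewrite sum_conj_colD // -/D tD -rmorphD modF_ofR ger0_norm; last first.
  by rewrite addr_ge0 ?ncc_ge0 // mulr_ge0 // ltW.
move: ub; under eq_bigr do rewrite powRr1 //.
rewrite powRr1 // => /(ler_wpM2l c_ge0) ub /le_trans /(_ ub) h.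
(* The two bounds give [n c^2 + e |D| <= n c^2 (1 + e^r)], which is the goal multiplied by [e]. *)
rewrite -(ler_pM2l e0) mulrCA mulr_powRB1 ?(ltW e0) ?(lt_trans ltr01) //.
by move: h; rewrite mulrDr mulr1; lra.
Qed.

(** [inner] conjugates column [k] instead of column [j], so the previous identity is conjugated. *)
Lemma E11_inner j k : E11 modF p q A -> (forall i, modF (A i j) = c) -> k != j ->
  inner conjF (A ^~ j) (A ^~ k) = 0.
Proof.
move=> EA jc kj; rewrite -(rmorph0 conjF) -(E11_column_orthogonal EA jc kj).
by rewrite rmorph_sum; apply: eq_bigr => i _; rewrite rmorphM conjFK.
Qed.

(* The real scalar [e] makes the cross terms of [|a + e b|^2] cancel in the sum
   over the entries, by orthogonality. *)
Lemma sum_modF_sqrD j (b : 'I_n -> F) e : (forall i, modF (A i j) = c) ->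
  \sum_i conjF (A i j) * b i = 0 ->
  \sum_i modF (A i j + ofR e * b i) ^+ 2 =
  n%:R * c ^+ 2 + e ^+ 2 * \sum_i modF (b i) ^+ 2.
Proof.
move=> jc ab; apply: (fmorph_inj ofR).
have ba : \sum_i A i j * conjF (b i) = 0.
  transitivity (conjF (\sum_i conjF (A i j) * b i)); last by rewrite ab rmorph0.
  by rewrite rmorph_sum; apply: eq_bigr => i _; rewrite rmorphM conjFK.
rewrite rmorph_sum rmorphD -(sum_conj_col jc) rmorphM rmorph_sum /=.
transitivity (\sum_i (conjF (A i j) * A i j + ofR e * (conjF (A i j) * b i) +
    ofR e * (A i j * conjF (b i)) + ofR (e ^+ 2) * ofR (modF (b i) ^+ 2))).
  apply: eq_bigr => i _.
  by rewrite -!modF_sqr rmorphD rmorphM conjF_ofR rmorphXn /=; ring.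
by rewrite !big_split /= -!mulr_sumr ab ba !mulr0 !addr0.
Qed.

Lemma E11_other_columns0 j k : (2%:E < p)%E -> E11 modF p q A ->
  0 < c -> (forall i, modF (A i j) = c) -> k != j -> forall i, A i k = 0.
Proof.
move=> p2 EA c0 jc kj.
have ab := E11_column_orthogonal EA jc kj.
have [s /andP[s1 s2] sq] := exponent_between12 q_gt1.
have [r r2 rp] := ereal_between p2.
have sr : 1 <= s <= r by rewrite (ltW s1) (le_trans s2 (ltW r2)).
pose B := \sum_i modF (A i k) ^+ 2.
have B0 : B <= 0.
  (* Bounds all [w i] below uniformly in [e <= 1], since [w i <= 1 + e |a_ik| / c]. *)
  pose M := 1 + \sum_i modF (A i k) / c.
  have M1 : 1 <= M by rewrite lerDl sumr_ge0 // => i _; rewrite divr_ge0.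
  have M0 : 0 < M := lt_le_trans ltr01 M1.
  pose K := (s - 1) ^+ 2 / M.
  have K0 : 0 < K by rewrite divr_gt0 // exprn_gt0 // subr_gt0.
  (* Holds because [2 (s-1)^2 <= s] on [(1,2]]. It allows [s * P] to be replaced by [2 * K * P] once
     [P >= 0] is known. *)
  have K2 : 2 * K <= s.
    by rewrite /K mulrA ler_pdivrMr //; nra.
  apply: (@le0_of_powR_bound R _ (n%:R * c ^+ 2 / K) (r - 2)); first by rewrite subr_gt0.
  move=> e /andP[e0 e1].
  pose y i := A i j + ofR e * A i k.
  pose w i := modF (y i) / c.
  have modte : modF (ofR e) = e by rewrite modF_ofR ger0_norm // ltW.
  have wM i : 0 <= w i <= M.
    rewrite divr_ge0 //= ler_pdivrMr //.
    apply: le_trans (modFD _ _) _; rewrite jc modFM modte mulrDl mul1r lerD2l.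
    rewrite mulr_suml (bigD1 i) //= divfK ?gt_eqF // -[leLHS]addr0 lerD //.
      by rewrite ler_piMl.
    by apply: sumr_ge0 => l _; rewrite mulr_ge0 ?divr_ge0.
  have w_ge i : 1 + s * (w i - 1) + K * (w i - 1) ^+ 2 <= w i `^ s.
    by apply: powR_ge_quadratic; rewrite ?wM ?s1.
  have sum_ws : \sum_i w i `^ s <= n%:R * (1 + e `^ r).
    have := E11_two_columns (ofR e) EA sr rp sq kj; rewrite modte => h.
    under eq_bigr do rewrite powRM ?invr_ge0 // -(powR_inv1 c_ge0) powRAC.
    rewrite -mulr_suml powR_inv1 ?powR_ge0 // ler_pdivrMr ?powR_gt0 //.
    by apply: le_trans h _; rewrite mulrAC.
  pose P := \sum_i (w i - 1); pose Q := \sum_i (w i - 1) ^+ 2.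
  (* By orthogonality the pairing of [y] with column [j] is still [n c^2], so duality gives the
     [w i] a mean of at least 1. *)
  have P0 : 0 <= P.
    have := modF_sum_conj_le y jc.
    rewrite sum_conj_colD // ab mulr0 addr0 modF_ofR ger0_norm; last first.
      exact: ncc_ge0.
    rewrite /P sumrB subr_ge0 sumr_const card_ord -mulr_suml ler_pdivlMr //.
    by rewrite expr2 mulrA mulrC ler_pM2l.
  (* Since [2 (w-1) + (w-1)^2 = w^2 - 1], the left side is the growth of the squared 2-norm, in
     units of [c^2]. *)
  have PQ : 2 * P + Q = e ^+ 2 * B / c ^+ 2.
    have := sum_modF_sqrD e jc ab; rewrite -/B => /(congr1 (fun z => z / c ^+ 2)).
    rewrite mulrDl mulfK ?sqrf_eq0 ?gt_eqF // mulr_suml => h.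
    apply: (addrI n%:R); rewrite -h.
    rewrite /P /Q mulr_sumr -big_split /=.
    have -> : n%:R = \sum_(i < n) (1 : R) by rewrite sumr_const card_ord.
    rewrite -big_split /=; apply: eq_bigr => i _; rewrite /w /y.
    by field; rewrite gt_eqF.
  have main : s * P + K * Q <= n%:R * e `^ r.
    have := le_trans (ler_sum _ (fun i _ => w_ge i)) sum_ws.
    rewrite !big_split /= -!mulr_sumr sumr_const card_ord -/P -/Q mulrDr mulr1.
    by rewrite -addrA lerD2l.
  have main2 : K * (2 * P + Q) <= n%:R * e `^ r.
    by apply: le_trans main; rewrite mulrDr lerD2r mulrA [K * 2]mulrC ler_wpM2r.
  have er : e `^ r = e `^ (r - 2) * e ^+ 2.
    by rewrite -powR_mulrn ?(ltW e0) // -powRD ?subrK // (gt_eqF e0) implybT.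
  move: main2; rewrite PQ er => main2.
  have e2 : 0 < e ^+ 2 by rewrite exprn_gt0.
  (* Multiplying by this factor isolates [B] and leaves [B <= (n c^2 / K) e^(r-2)], with
     [r - 2 > 0]. *)
  have f0 : 0 < c ^+ 2 / (K * e ^+ 2) := divr_gt0 (exprn_gt0 2 c0) (mulr_gt0 K0 e2).
  move: main2; rewrite -(ler_pM2r f0).
  have -> : K * (e ^+ 2 * B / c ^+ 2) * (c ^+ 2 / (K * e ^+ 2)) = B.
    by field; rewrite !gt_eqF.
  set E := e `^ (r - 2).
  have -> // : n%:R * (E * e ^+ 2) * (c ^+ 2 / (K * e ^+ 2)) = n%:R * c ^+ 2 / K * E.
  by field; rewrite !gt_eqF.
move=> i; apply: modF_eq0; apply/eqP; rewrite -sqrf_eq0 eq_le sqr_ge0 andbT.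
apply: le_trans B0; rewrite /B (bigD1 i) //= lerDl.
by apply: sumr_ge0 => l _; exact: sqr_ge0.
Qed.

(** The upper bound chains [||Ax||_s <= n^(1/s-1/q) ||Ax||_q] with [||x||_p <= ||x||_r]; the
    constant-modulus column, tested by [e_j], attains it. *)
Lemma E11_of_column :
  (exists j, forall i, modF (A i j) = n%:R `^ (- einv q) * opnorm modF p q A) ->
  E11 modF p q A.
Proof.
case=> j jN r s r1 rp s1 sq.
have s0 : 0 < s := lt_le_trans ltr01 s1.
have r0 : 0 < r := lt_le_trans ltr01 r1.
have sE : (1 <= s%:E)%E by rewrite lee_fin.
have rE : (1 <= r%:E)%E by rewrite lee_fin.
have N0 := opnorm_ge0 A m_gt0 p_ge1 q_ge1.
apply/eqP; rewrite eq_le; apply/andP; split.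
  apply: opnorm_le => // x x0.
  apply: le_trans (lpnorm_power_mean modF_ge0 _ n_gt0 s0 (ltW sq)) _.
  rewrite -mulrA ler_wpM2l ?powR_ge0 //.
  apply: le_trans (lpnorm_mulmx_le A p_ge1 q_ge1 x0) _.
  by rewrite ler_wpM2l // lpnorm_exponent_le // ltW.
apply: le_trans (lpnorm_col_le A j rE sE).
rewrite /lp (lpnorm_const modF_ge0 n_gt0 _ jN) ?lte_fin //= mulrA -powRD //.
by rewrite (gt_eqF n_gt0R) implybT.
Qed.

(** Here [|(Ax)_l| = a |x_j|] for every [l], so the norm at [(p,q)] is [n^(1/q) a] and column [j]
    meets the criterion of [E11_of_column]. *)
Lemma E11_single_column j : (forall k, k != j -> forall i, A i k = 0) ->
  (forall i i', modF (A i j) = modF (A i' j)) -> E11 modF p q A.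
Proof.
move=> A0 Aj; apply: E11_of_column; exists j => i.
pose a := modF (A i j); have ja l : modF (A l j) = a := Aj _ _.
suff -> : opnorm modF p q A = n%:R `^ (einv q) * a.
  rewrite mulrA -powRD ?addNr ?powRr0 ?mul1r //.
  by rewrite (gt_eqF n_gt0R) implybT.
apply/eqP; rewrite eq_le; apply/andP; split; last first.
  by rewrite -(lpnorm_const modF_ge0 n_gt0 q_gt0 ja); exact: lpnorm_col_le.
apply: opnorm_le => // x x0.
have Ax l : modF ((A *m x) l 0) = a * modF (x j 0).
  rewrite mxE (bigD1 j) //= big1 ?addr0 => [|k kj]; last by rewrite A0 ?mul0r.
  by rewrite modFM ja.
rewrite /lp (lpnorm_const modF_ge0 n_gt0 q_gt0 Ax) mulrA.
apply: ler_wpM2l; first exact: mulr_ge0 (powR_ge0 _ _) (modF_ge0 _).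
exact: (modF_le_lpnorm modF_ge0 (x ^~ 0)).
Qed.

Lemma E11_iff_single_column : (2%:E < p)%E -> A != 0 ->
  E11 modF p q A <->
  exists j, (forall k, k != j -> forall i, A i k = 0) /\
            (forall i i', modF (A i j) = modF (A i' j)).
Proof.
move=> p2 A0; split=> [EA|[j [? ?]]]; last exact: (@E11_single_column j).
have [j _ js] := @eq_bigmax _ R _ 0 (Ordinal m_gt0) predT (colnorm1 modF A) isT
  (fun j _ => sumr_ge0 _ (fun i _ => modF_ge0 (A i j))).
have jc := E11_max_column_const EA (esym js).
(* If [c] were 0, every column would have 1-norm 0, against [A != 0]. *)
have c0 : 0 < c.
  rewrite lt_def c_ge0 andbT; apply: contra A0 => /eqP c0.
  have s0 : sigma = 0.
    by move/eqP: c0; rewrite mulf_eq0 invr_eq0 (gt_eqF n_gt0R) => /eqP.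
  apply/eqP/matrixP => i k; rewrite mxE; apply: modF_eq0; apply/eqP.
  rewrite eq_le modF_ge0 andbT -s0; apply: le_trans (colnorm1_le_max A k).
  by rewrite /colnorm1 (bigD1 i) //= lerDl sumr_ge0.
exists j; split=> [k kj i|i i']; last by rewrite !jc.
exact: (E11_other_columns0 p2 EA c0 jc kj).
Qed.

End ExtremalMatrices.

(** * Assembly, then the real and complex fields *)

Lemma theorem4_for_modulus : @theorem4_for R F modF conjF.
Proof.
move=> n m A p q n0 m0 p1 q1 sigma; split.
- by move=> EA j js; apply: (E11_max_column_const n0 m0 p1 q1 EA js).
- by move=> EA j jc k kj; apply: (E11_inner n0 m0 p1 q1 EA jc kj).
- exact: E11_sigma.
- exact: E11_of_column.
- exact: E11_iff_single_column.
Qed.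

End Modulus.

Theorem theorem4 (R : realType) : theorem4_real R /\ theorem4_complex R.
Proof.
split.
(* Over the reals, conjugation and the embedding are both the identity. *)
- apply: (@theorem4_for_modulus R R Num.norm idfun idfun) => //.
  + exact: ler_normD.
  + by move=> x; rewrite /= real_normK ?num_real.
- apply: (@theorem4_for_modulus R R[i] (@ComplexField.Normc.normc R)
            (@conjc R) (real_complex R)).
  + by case=> a b; exact: sqrtr_ge0.
  + exact: le_normcD.
  + case=> a b.
    rewrite /= sqr_sqrtr ?addr_ge0 ?sqr_ge0 //.
    by apply/eqP; rewrite eq_complex /=; apply/andP; split; apply/eqP; ring.
  + by case=> a b; rewrite /= opprK.
  + by move=> a; rewrite /= oppr0.
Qed.
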